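(* Let $d\ge1$. For any unit vectors $u_1,\dots,u_d\in\mathbb C^d$ and any vectors $y_1,\dots,y_d\in\mathbb C^d$, there exists a unit vector $x\in\mathbb C^d$ such that \[ |\langle x-y_1,u_1\rangle|\cdots|\langle x-y_d,u_d\rangle|\ge d^{-d/2}. \]
   Context: $\langle\cdot,\cdot\rangle$ is the standard Hermitian product on $\mathbb C^d$, and unit vectors are taken with respect to the corresponding norm. *)

(* Defs.v *)
From HB Require Import structures.
From mathcomp Require Export all_boot all_order all_algebra.
From mathcomp Require Export complex spectral.
From mathcomp Require Export reals exp.
Set Implicit Arguments.
Unset Strict Implicit.
Unset Printing Implicit Defensive.
Import Order.TTheory GRing.Theory Num.Theory.
Local Open Scope ring_scope.

(* Vectors of C^d are rows over R[i]; [dotmx u v = (u *m v ^t* ) 0 0] is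
   the standard Hermitian product, linear in its first argument.  The norm
   is a nonnegative element of R[i], as are all norms in R[i]. *)
Definition hermitian_norm (R : realType) (d : nat) (u : 'rV[R[i]]_d) : R[i] :=
  sqrtC (dotmx u u).

Definition unit_vector (R : realType) (d : nat) (u : 'rV[R[i]]_d) : Prop :=
  hermitian_norm u = 1.

(* Main.v *)
(* Multiplying [x] by phases, the constant-coefficient bound for polynomials on
   the unit circle shows that the translations [y j] can only increase the
   maximum of the product, so it suffices to treat [Q x = prod_k <x, u k>].  At
   a maximizer [x] of [|Q|] on the sphere every factor satisfies
   [|<x, u j>|^2 >= 1/d]: dilating the component of [x] along [u j] by
   [s = r e^{i theta}] multiplies [|Q|] by at least [r] for a suitable [theta]
   (maximum principle for the other factors, a polynomial in [s]), hence
   [r^2 <= (1 + (r^2 - 1) |<x, u j>|^2)^d] for all [r > 1]; let [r] tend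
   to [1]. *)
Require Import Defs.
From mathcomp Require Import all_solvable all_field zify ring lra.
From mathcomp Require Import boolp classical_sets topology normedtype derive.
Import numFieldNormedType.Exports.
Set Implicit Arguments.
Unset Strict Implicit.
Unset Printing Implicit Defensive.
Import Order.TTheory GRing.Theory Num.Theory.
Local Open Scope ring_scope.
Local Open Scope complex_scope.

(** * Polynomials on circles, the maximum modulus principle and elementary inequalities *)

Lemma sum_prim_root_expr (F : fieldType) (N m : nat) (w : F) :
    N.-primitive_root w ->
  \sum_(k < N) w ^+ (k * m) = if (N %| m)%N then N%:R else 0.
Proof.
move=> wN; case: ifPn => [Nm | Nm].
  rewrite (eq_bigr (fun=> 1)) => [|k _]; first by rewrite sumr_const card_ord.
  by apply/eqP; rewrite -(prim_order_dvd wN) dvdn_mull.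
have w1 : w ^+ m - 1 != 0 by rewrite subr_eq0 -(prim_order_dvd wN).
apply: (mulfI w1); rewrite mulr0.
under eq_bigr => k _ do rewrite mulnC exprM.
by rewrite -subrX1 -exprM mulnC exprM (prim_expr_order wN) expr1n subrr.
Qed.

Lemma closed_prim_root_exists (F : numClosedFieldType) (n : nat) : (0 < n)%N ->
  exists w : F, n.-primitive_root w.
Proof.
move=> n0; have [rs Ers] := closed_field_poly_normal ('X^n - 1 : {poly F}).
rewrite (monicP (monicXnsubC 1 n0)) scale1r in Ers.
have rs_unity : all n.-unity_root rs.
  by apply/allP => z; rewrite -root_prod_XsubC -Ers.
have rs_uniq : uniq rs.
  by rewrite -separable_prod_XsubC -Ers separable_Xn_sub_1 // pnatr_eq0 -lt0n.
have rs_size : (n < (size rs).+1)%N.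
  by rewrite -(size_prod_XsubC rs id) -Ers size_XnsubC.
by have /hasP[w _ wn] := has_prim_root n0 rs_unity rs_uniq rs_size; exists w.
Qed.

(** A discrete Cauchy estimate: averaging [q] over equally spaced points of the circle, with roots
    of unity as weights, isolates one coefficient, and some sample is at least as large as the
    mean. *)
Lemma poly_coef_le_circle (C : numClosedFieldType) (q : {poly C}) (j : nat)
    (r : C) : 0 < r ->
  exists s, `|s| = r /\ `|q`_j| * r ^+ j <= `|q.[s]|.
Proof.
move=> r0; pose N := (size q + j).+1.
have [w wN] := @closed_prim_root_exists C _ (ltn0Sn (size q + j)).
have w1 k : `|w ^+ k| = 1.
  have : `|w| ^+ N == 1 by rewrite -normrX (prim_expr_order wN) normr1.
  by rewrite pexprn_eq1 // normrX => /eqP ->; rewrite expr1n.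
(* The exponent [N - j] stands for [-j]. Orthogonality leaves only [i = j], because [N] exceeds [j]
   and all degrees: for [i < N], [N] divides [i + (N - j)] only when [i = j]. *)
have avg : \sum_(k < N) q.[r * w ^+ k] * w ^+ (k * (N - j)) =
    N%:R * (q`_j * r ^+ j).
  have szq : (size q <= N)%N by rewrite /N; lia.
  have jN : (j < N)%N by rewrite /N; lia.
  under eq_bigr => k _ do rewrite (horner_coef_wide _ szq) mulr_suml.
  rewrite exchange_big /= (bigD1 (Ordinal jN)) //= [X in _ + X]big1 ?addr0.
    under eq_bigr => k _.
      rewrite exprMn -exprM mulrA -mulrA -exprD -mulnDr subnKC ?(ltnW jN) //.
      over.
    by rewrite -mulr_sumr sum_prim_root_expr // dvdnn mulrC.
  move=> i ij; under eq_bigr => k _.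
    rewrite exprMn -exprM mulrA -mulrA -exprD -mulnDr.
    over.
  rewrite -mulr_sumr sum_prim_root_expr // ifN ?mulr0 //.
  apply/negP => /dvdnP [m em]; move/negP: ij; apply; apply/eqP/val_inj => /=.
  have iN := ltn_ord i; move: em jN iN; rewrite -/N; clearbody N => em jN iN.
  have m1 : m = 1%N by case: m em => [|[|m]] em //; first lia; nia.
  by rewrite m1 mul1n in em; lia.
case: (boolP [exists k : 'I_N, `|q`_j| * r ^+ j <= `|q.[r * w ^+ k]|]).
  case/existsP => k hk; exists (r * w ^+ k); split=> //.
  by rewrite normrM w1 mulr1 gtr0_norm.
rewrite negb_exists => /forallP lt.
(* If every sample were below the bound, the average would be strictly smaller than itself. *)
suff : N%:R * (`|q`_j| * r ^+ j) < N%:R * (`|q`_j| * r ^+ j) by rewrite ltxx.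
have nE : `|N%:R * (q`_j * r ^+ j)| = N%:R * (`|q`_j| * r ^+ j).
  by rewrite !normrM normr_nat normrX (gtr0_norm r0).
rewrite -{1}nE -avg; apply: (le_lt_trans (ler_norm_sum _ _ _)).
rewrite [ltRHS]mulr_natl -[X in _ *+ X]card_ord -sumr_const.
apply: ltr_sum => [|k _].
  by apply/hasP; exists ord0; rewrite ?mem_index_enum.
rewrite normrM w1 mulr1; have := lt k.
by rewrite real_ltNge // ?realM ?realX ?normr_real ?gtr0_real.
Qed.

(** If [a < b], Bernoulli's inequality makes [(b / a) ^+ N] grow at least linearly in [N], so no
    constant [K] can bound it. *)
Lemma le_of_expr_le_scale (R : archiRealFieldType) (a b K : R) : 0 <= a ->
  (forall N, b ^+ N <= a ^+ N * K) -> b <= a.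
Proof.
move=> a0 h; rewrite leNgt; apply/negP => ab.
have [a_eq0 | a_neq0] := eqVneq a 0.
  by have := h 1%N; rewrite !expr1 a_eq0 mul0r -a_eq0 leNgt ab.
have {a0} a_gt0 : 0 < a by rewrite lt_def a_neq0.
pose e := b / a - 1.
have e_gt0 : 0 < e by rewrite subr_gt0 ltr_pdivlMr // mul1r.
have bernoulli N : 1 + N%:R * e <= (1 + e) ^+ N.
  elim: N => [|N IH]; first by rewrite mul0r addr0 expr0.
  rewrite exprS; apply: le_trans (ler_wpM2l _ IH).
    by rewrite -natr1 -subr_ge0; have := ler0n R N; nra.
  by rewrite addr_ge0 ?ltW.
have powK N : (1 + e) ^+ N <= K.
  by rewrite addrC subrK expr_div_n ler_pdivrMr ?exprn_gt0 // mulrC.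
have K0 : 0 <= K by apply: le_trans (powK 0%N); rewrite expr0.
have := archi_boundP (divr_ge0 K0 (ltW e_gt0)).
rewrite ltr_pdivrMr // ltNge => /negP; apply.
by apply: le_trans (powK _); apply: le_trans (bernoulli _); rewrite ler_wpDl.
Qed.

Lemma sum_geometric_le (F : numFieldType) (r : F) n : 1 < r ->
  \sum_(i < n) r^-1 ^+ i <= r / (r - 1).
Proof.
move=> r1; have r0 : 0 < r := lt_trans ltr01 r1.
have d0 : 0 < r - 1 by rewrite subr_gt0.
have -> : r - 1 = r * (1 - r^-1) by rewrite mulrBr mulr1 mulfV ?gt_eqF.
rewrite ler_pdivlMr; last by move: d0; rewrite mulrBr mulr1 mulfV ?gt_eqF.
rewrite mulrC -mulrA -opprB mulNr -subrX1 opprB.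
by rewrite ler_piMr ?(ltW r0) // lerBlDr lerDl exprn_ge0 // invr_ge0 ltW.
Qed.

(** The coefficient estimates give at most [A / r ^+ i] in degree [i], and these sum to a geometric
    series. *)
Lemma horner1_le_circle (C : numClosedFieldType) (q : {poly C}) (r A : C) :
    1 < r -> (forall s : C, `|s| = r -> `|q.[s]| <= A) ->
  `|q.[1]| <= A * (r / (r - 1)).
Proof.
move=> r1 qA; have r0 : 0 < r := lt_trans ltr01 r1.
have A0 : 0 <= A by apply: le_trans (qA r (gtr0_norm r0)).
have := ler_wpM2l A0 (sum_geometric_le (size q) r1); apply: le_trans.
rewrite horner_coef mulr_sumr; apply: (le_trans (ler_norm_sum _ _ _)).
apply: ler_sum => i _; rewrite expr1n mulr1 exprVn ler_pdivlMr ?exprn_gt0 //.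
by have [s [/qA sA le_s]] := poly_coef_le_circle q i r0; apply: le_trans sA.
Qed.

(* Cauchy's estimate bounds [|q(1)|] up to a constant depending only on [r];
   applied to the powers of [q], the constant disappears. *)
Lemma maximum_modulus (R : realType) (q : {poly R[i]}) (r A : R[i]) : 1 < r ->
  (forall s : R[i], `|s| = r -> `|q.[s]| <= A) -> `|q.[1]| <= A.
Proof.
move=> r1 qA; have r0 : 0 < r := lt_trans ltr01 r1.
have A0 : 0 <= A by apply: le_trans (qA r (gtr0_norm r0)).
have /complex_realP[a Ea] := ger0_real A0.
have /complex_realP[b Eb] := normr_real q.[1].
have /complex_realP[K EK] : r / (r - 1) \is Num.real.
  by rewrite realM ?realV ?realB ?gtr0_real.
rewrite Ea Eb lecR; apply: (@le_of_expr_le_scale _ _ _ K).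
  by rewrite -ler0c -Ea.
move=> N; rewrite -lecR rmorphM !rmorphXn /= -Ea -Eb -EK -normrX -horner_exp.
apply: horner1_le_circle => // s sr; rewrite horner_exp normrX.
by rewrite lerXn2r ?nnegrE ?qA.
Qed.

(** To first order at [t = 0] the hypothesis reads [1 <= n * a]; the limit is replaced by a single
    explicit [t]. *)
Lemma ge_invn_of_pow_bound (R : realFieldType) (n : nat) (a : R) :
    (0 < n)%N -> 0 <= a ->
  (forall t, 0 < t -> 1 + t <= (1 + t * a) ^+ n) -> n%:R^-1 <= a.
Proof.
move=> n0 a0 h; rewrite leNgt; apply/negP => a_lt.
have nR : 0 < n%:R :> R by rewrite ltr0n.
have na1 : n%:R * a < 1 by rewrite -ltr_pdivlMl // mulr1.
(* With this choice the final difference of the two sides is exactly [t * (t * (t + a))], which is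
   positive. *)
pose t := 1 - n%:R * a.
have t0 : 0 < t by rewrite subr_gt0.
have ta0 : 0 < 1 + t * a by rewrite ltr_pwDl // mulr_ge0 // ltW.
(* Chosen so that [1 - x] is the inverse of [1 + t * a]; Bernoulli then bounds the inverse power
   from below. *)
pose x := t * a / (1 + t * a).
have x1 : x < 1 by rewrite ltr_pdivrMr // mul1r ltrDr.
have bernoulli m : 1 - m%:R * x <= (1 - x) ^+ m.
  have x0 : 0 <= x by rewrite divr_ge0 ?mulr_ge0 // ltW.
  elim: m => [|m IH]; first by rewrite mul0r subr0 expr0.
  rewrite exprS; apply: le_trans (ler_wpM2l _ IH); last by rewrite subr_ge0 ltW.
  by rewrite -natr1 -subr_ge0; have := ler0n R m; nra.
have : (1 + t) * (1 - n%:R * x) <= 1.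
  have E : (1 + t * a) ^+ n * (1 - x) ^+ n = 1.
    rewrite -exprMn (_ : _ * _ = 1) ?expr1n //.
    by rewrite mulrBr mulr1 /x [X in _ - X]mulrC divfK ?gt_eqF // addrK.
  rewrite -[leRHS]E; apply: (@le_trans _ _ ((1 + t) * (1 - x) ^+ n)).
    by rewrite ler_wpM2l ?bernoulli // addr_ge0 // ltW.
  by rewrite ler_wpM2r ?exprn_ge0 ?subr_ge0 ?h // ltW.
have Ex : x * (1 + t * a) = t * a by rewrite /x divfK ?gt_eqF.
move/(ler_wpM2r (ltW ta0)); rewrite mul1r -mulrA mulrBl mul1r -(mulrA _ x) Ex.
rewrite leNgt => /negP; apply.
rewrite -subr_gt0.
rewrite (_ : _ - _ = t * (1 + t * a - (1 + t) * (n%:R * a))); last by ring.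
rewrite mulr_gt0 //.
rewrite (_ : _ - _ = t * (t + a)); last by rewrite /t; ring.
by rewrite mulr_gt0 // ltr_wpDr.
Qed.

(** * Hermitian norm, dilation along a unit vector, and the factors at a maximizer *)

Lemma hermitian_normK (R : realType) d (v : 'rV[R[i]]_d) :
  hermitian_norm v ^+ 2 = dotmx v v.
Proof. exact: sqrtCK. Qed.

Lemma hermitian_norm_ge0 (R : realType) d (v : 'rV[R[i]]_d) :
  0 <= hermitian_norm v.
Proof. exact: (sqrt_dnorm_ge0 (@dotmx _ d)). Qed.

Lemma unit_vectorE (R : realType) d (v : 'rV[R[i]]_d) :
  unit_vector v <-> dotmx v v = 1.
Proof.
rewrite /unit_vector -hermitian_normK; split=> [-> | /eqP]; first exact: expr1n.
by rewrite sqrp_eq1 ?hermitian_norm_ge0 // => /eqP.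
Qed.

Lemma hermitian_normZ (R : realType) d (c : R[i]) (v : 'rV[R[i]]_d) :
  hermitian_norm (c *: v) = `|c| * hermitian_norm v.
Proof.
apply: (pexpIrn (n := 2)); rewrite ?nnegrE ?mulr_ge0 ?hermitian_norm_ge0 //.
by rewrite exprMn !hermitian_normK (dnormZ (@dotmx _ d)).
Qed.

Lemma dotmx_dilate (C : numClosedFieldType) d (x e f : 'rV[C]_d) (s : C) :
  dotmx (x + ((s - 1) * dotmx x e) *: e) f =
  dotmx x f + (s - 1) * (dotmx x e * dotmx e f).
Proof. by rewrite linearDl linearZl_LR /= mulrA. Qed.

(** The component of [x] along [e] is multiplied by [s] and the orthogonal one is unchanged, so
    Pythagoras applies. *)
Lemma dnorm_dilate (C : numClosedFieldType) d (x e : 'rV[C]_d) (s : C) :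
    dotmx e e = 1 ->
  let y := x + ((s - 1) * dotmx x e) *: e in
  dotmx y y = dotmx x x + (`|s| ^+ 2 - 1) * `|dotmx x e| ^+ 2.
Proof.
move=> e1 /=; set c := (s - 1) * _.
have -> : dotmx (x + c *: e) (x + c *: e) =
    dotmx x x + dotmx (c *: e) (c *: e) +
    (dotmx x (c *: e) + (dotmx x (c *: e))^*).
  exact: (dnormD (@dotmx C d)).
have -> : dotmx (c *: e) (c *: e) = `|c| ^+ 2.
  by rewrite (dnormZ (@dotmx _ d)) /= e1 mulr1.
have -> : dotmx x (c *: e) = c^* * dotmx x e by exact: linearZr_LR.
rewrite !normCK /c !rmorphM !rmorphB !rmorph1 /= !conjCK.
ring.
Qed.

(* Only the component of [x] along [u j] is dilated, by a complex factor [s]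
   of modulus [r > 1]: the product picks up the factor [s] and a polynomial in
   [s], and by the maximum principle its modulus grows at least by [r] for some
   [s], while the squared norm grows only to [1 + (r^2 - 1) |<x, u j>|^2]. *)
Lemma maximizer_factor_ge (R : realType) d (u : 'I_d -> 'rV[R[i]]_d) x :
    (forall j, unit_vector (u j)) -> unit_vector x ->
    (forall v, `|\prod_k dotmx v (u k)| <=
       `|\prod_k dotmx x (u k)| * hermitian_norm v ^+ d) ->
    \prod_k dotmx x (u k) != 0 ->
  forall j, d%:R^-1 <= `|dotmx x (u j)| ^+ 2.
Proof.
move=> u1 /unit_vectorE x1 x_max Qx0 j; set w := dotmx x (u j).
have d0 : (0 < d)%N := leq_ltn_trans (leq0n j) (ltn_ord j).
have /complex_realP[a Ea] : `|w| ^+ 2 \is Num.real by rewrite realX ?normr_real.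
have a0 : 0 <= a by rewrite -ler0c -Ea exprn_ge0.
rewrite Ea -(rmorph_nat (real_complex R)) -fmorphV lecR.
apply: ge_invn_of_pow_bound => // t t0.
(* [r ^+ 2 - 1 = t], and [h] will be the norm of the dilated vector [y s] for every [s] of modulus
   [r]. *)
pose r : R[i] := (Num.sqrt (1 + t))%:C; pose h := sqrtC (1 + t * a)%:C.
have t1 : 0 <= 1 + t by rewrite addr_ge0 ?ltW.
have ta1 : 0 <= 1 + t * a by rewrite addr_ge0 // mulr_ge0 // ltW.
have r2 : r ^+ 2 = (1 + t)%:C by rewrite /r -rmorphXn /= sqr_sqrtr.
have r1 : 1 < r.
  rewrite -(rmorph1 (real_complex R)) ltcR -[ltLHS]sqrtr1.
  by rewrite ltr_sqrt ?ltrDl // addr_gt0.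
have r0 : 0 < r := lt_trans ltr01 r1.
have h0 : 0 <= h by rewrite sqrtC_ge0 ler0c.
suff rh : r <= h ^+ d.
  rewrite -lecR -r2 rmorphXn /= -(sqrtCK (1 + t * a)%:C) -/h exprAC.
  by rewrite lerXn2r ?nnegrE ?exprn_ge0 // ltW.
pose y s := x + ((s - 1) * w) *: u j.
pose q := \prod_(k | k != j)
  ((dotmx x (u k))%:P + ('X - 1) * (w * dotmx (u j) (u k))%:P).
have qE s : q.[s] = \prod_(k | k != j) dotmx (y s) (u k).
  by rewrite horner_prod; apply: eq_bigr => k _; rewrite dotmx_dilate !hornerE.
have yj s : dotmx (y s) (u j) = s * w.
  have /unit_vectorE uj := u1 j.
  by rewrite dotmx_dilate uj -/w; ring.
have yQ s : `|\prod_k dotmx (y s) (u k)| = `|s| * `|w| * `|q.[s]|.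
  by rewrite (bigD1 j) //= yj qE !normrM.
have y1 : y 1 = x by rewrite /y subrr mul0r scale0r addr0.
have Qx : `|\prod_k dotmx x (u k)| = `|w| * `|q.[1]|.
  by rewrite -{1}y1 yQ normr1 mul1r.
move: Qx0; rewrite -normr_eq0 Qx mulf_eq0 negb_or => /andP[w0 q0].
have w_gt0 : 0 < `|w| by rewrite lt_def w0 normr_ge0.
have q_gt0 : 0 < `|q.[1]| by rewrite lt_def q0 normr_ge0.
(* The point [s = 1], where [y 1 = x], lies inside the circle of radius [r], on which maximality of
   [x] bounds [q]. *)
have : `|q.[1]| <= `|q.[1]| * h ^+ d / r.
  apply: (maximum_modulus r1) => s sr; rewrite ler_pdivlMr //.
  have := x_max (y s); rewrite yQ Qx sr.
  have -> : hermitian_norm (y s) = h.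
    have /unit_vectorE uj := u1 j.
    rewrite /hermitian_norm dnorm_dilate // x1 sr r2 -/w Ea /h.
    by congr sqrtC; rewrite !rmorphD rmorphM rmorph1 /=; ring.
  by rewrite [r * _]mulrC -!mulrA ler_pM2l // mulrC.
by rewrite ler_pdivlMr // ler_pM2l.
Qed.

(** * Nonvanishing of the product and choice of the phase *)

Lemma exists_nonvanishing (C : numClosedFieldType) n d (u : 'I_n -> 'rV[C]_d) :
    (forall j, u j != 0) ->
  exists v : 'rV[C]_d, \prod_k dotmx v (u k) != 0.
Proof.
(* On the moment curve [v = (1, s, s^2, ...)] each [dotmx v (u k)] is a nonzero polynomial in [s],
   with conjugated coefficients since the product is antilinear on the right. *)
move=> u0; pose p k : {poly C} := rVpoly (map_mx Num.conj (u k)).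
have p0 k : p k != 0.
  apply: contraNneq (u0 k) => pk0; apply/eqP/rowP => i.
  have := coef_rVpoly_ord (map_mx Num.conj (u k)) i.
  by rewrite -/(p k) pk0 coef0 !mxE => /esym/eqP; rewrite conjC_eq0 => /eqP.
have : \prod_k p k != 0 by apply/prodf_neq0 => k _.
rewrite -lead_coef_eq0 -normr_gt0 => lead_gt0.
(* The coefficient bound at the nonzero leading coefficient yields a point where the product does
   not vanish. *)
have [s [_]] := poly_coef_le_circle (\prod_k p k) (size (\prod_k p k)).-1 ltr01.
rewrite expr1n mulr1 => /(lt_le_trans lead_gt0); rewrite horner_prod.
move=> prod_gt0.
exists (\row_i s ^+ i).
rewrite -normr_gt0; congr (0 < `|_|): prod_gt0; apply: eq_bigr => k _.
rewrite (horner_coef_wide _ (size_poly _ _)) dotmxE mxE; apply: eq_bigr => i _.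
by rewrite coef_rVpoly_ord !mxE mulrC.
Qed.

(** The product of the [a k - b k * X] has constant coefficient [\prod_k a k], so some [s] on the
    unit circle does at least as well; multiplying every factor by [s^-1] moves the phase onto
    [a k]. *)
Lemma exists_dominating_phase (C : numClosedFieldType) n (a b : 'I_n -> C) :
  exists2 s : C, `|s| = 1 & \prod_k `|a k| <= \prod_k `|s * a k - b k|.
Proof.
pose p k : {poly C} := (a k)%:P - b k *: 'X.
have [s [s1]] := poly_coef_le_circle (\prod_k p k) 0 ltr01.
rewrite expr0 mulr1 -horner_coef0 !horner_prod !normr_prod => le_s.
have s0 : s != 0 by rewrite -normr_eq0 s1 oner_eq0.
exists s^-1; first by rewrite normfV s1 invr1.
have p0 : \prod_k `|(p k).[0]| = \prod_k `|a k|.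
  by apply: eq_bigr => k _; rewrite !hornerE ?mulr0 ?subr0.
have ps : \prod_k `|(p k).[s]| = \prod_k `|s^-1 * a k - b k|.
  apply: eq_bigr => k _.
  rewrite -[RHS]mul1r -{1}s1 -normrM !hornerE.
  by rewrite mulrBr mulVKf // [b k * s]mulrC.
by rewrite -p0 -ps.
Qed.

(** * Existence of a maximizer on the unit sphere by compactness *)

Section Compactness.
Local Notation Re := complex.Re.
Local Notation Im := complex.Im.
Local Open Scope classical_set_scope.
Local Open Scope ring_scope.
Variable R : realType.

Lemma continuous_sum (T : topologicalType) n (f : 'I_n -> T -> R) :
  (forall k, continuous (f k)) -> continuous (fun x => \sum_k f k x).
Proof. by move=> fc; apply: continuous_big => //; exact: add_continuous. Qed.

(** Continuity is tested on real and imaginary parts, so that only the topology of [R] enters. *)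
Definition complex_continuous (T : topologicalType) (f : T -> R[i]) :=
  continuous (fun x => Re (f x)) /\ continuous (fun x => Im (f x)).

Lemma complex_continuousM (T : topologicalType) (f g : T -> R[i]) :
  complex_continuous f -> complex_continuous g ->
  complex_continuous (fun x => f x * g x).
Proof.
move=> [fr fi] [gr gi]; split=> x.
  rewrite (_ : (fun x => _) =
    fun x => Re (f x) * Re (g x) - Im (f x) * Im (g x)).
    by apply: cvgB; apply: cvgM; [exact: fr|exact: gr|exact: fi|exact: gi].
  by apply/funext => z; case: (f z); case: (g z).
rewrite (_ : (fun x => _) =
  fun x => Re (f x) * Im (g x) + Im (f x) * Re (g x)).
  by apply: cvgD; apply: cvgM; [exact: fr|exact: gi|exact: fi|exact: gr].
by apply/funext => z; case: (f z); case: (g z).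
Qed.

Lemma complex_continuous_sum (T : topologicalType) n (f : 'I_n -> T -> R[i]) :
  (forall k, complex_continuous (f k)) ->
  complex_continuous (fun x => \sum_k f k x).
Proof.
move=> fc; split=> x.
  rewrite (_ : (fun x => _) = fun x => \sum_k Re (f k x)).
    by apply: continuous_sum => k; exact: (fc k).1.
  by apply/funext => z;
    exact: (raddf_sum (@Re R : {additive Rcomplex R -> R})).
rewrite (_ : (fun x => _) = fun x => \sum_k Im (f k x)).
  by apply: continuous_sum => k; exact: (fc k).2.
by apply/funext => z;
  exact: (raddf_sum (@Im R : {additive Rcomplex R -> R})).
Qed.

Lemma complex_continuous_prod (T : topologicalType) n (f : 'I_n -> T -> R[i]) :
  (forall k, complex_continuous (f k)) ->
  complex_continuous (fun x => \prod_k f k x).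
Proof.
move=> fc; elim: (index_enum 'I_n) => [|k s IH].
  by split=> x; under eq_fun do rewrite big_nil; exact: cvg_cst.
rewrite (_ : (fun x => _) = fun x => f k x * \prod_(j <- s) f j x).
  exact: complex_continuousM.
by apply/funext => x; rewrite big_cons.
Qed.

(** Identifies R^(2d) with C^d, real parts first, to use compactness of the real sphere. *)
Definition complex_row d (v : 'rV[R]_(d + d)) : 'rV[R[i]]_d :=
  \row_j (v 0 (lshift d j) +i* v 0 (rshift d j)).

Lemma complex_row_surj d (x : 'rV[R[i]]_d) : exists v, complex_row v = x.
Proof.
exists (row_mx (map_mx (@Re R) x) (map_mx (@Im R) x)).
by apply/rowP => j; rewrite mxE row_mxEl row_mxEr !mxE; case: (x 0 j).
Qed.

Lemma dnorm_complex_row d (v : 'rV[R]_(d + d)) :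
  dotmx (complex_row v) (complex_row v) = (\sum_i v 0 i ^+ 2)%:C.
Proof.
rewrite dotmxE mxE big_split_ord /= -big_split /= rmorph_sum.
by apply: eq_bigr => j _; rewrite !mxE -sqr_normc -add_Re2_Im2.
Qed.

Lemma complex_continuous_dotmx d (u : 'rV[R[i]]_d) :
  complex_continuous (fun v => dotmx (complex_row v) u).
Proof.
rewrite (_ : (fun v => _) = fun v => \sum_j complex_row v 0 j * (u 0 j)^*).
  apply: complex_continuous_sum => j; apply: complex_continuousM.
    by split=> v; under eq_fun do rewrite mxE /=; exact: coord_continuous.
  by split; exact: cst_continuous.
by apply/funext => v; rewrite dotmxE mxE; apply: eq_bigr => j _; rewrite !mxE.
Qed.

Lemma compact_unit_sphere n :
  compact [set v : 'rV[R]_n | \sum_i v 0 i ^+ 2 = 1].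
Proof.
apply: (@subclosed_compact _ _
  [set v : 'rV[R]_n | forall i, `[-1 : R, 1]%classic (v ord0 i)]).
- apply: (@preimage_closed _ _ (fun v : 'rV[R]_n => \sum_i v 0 i ^+ 2) [set 1]).
    move=> v _; apply: continuous_sum => {v} i v.
    have cv : {for v, continuous (fun z : 'rV[R]_n => z 0 i)}.
      exact: coord_continuous.
    by under eq_fun do rewrite expr2; exact: (continuousM cv cv).
  exact: closed_eq.
- apply: (@rV_compact R n (fun=> `[-1, 1]%classic)) => i.
  exact: segment_compact.
move=> v /= v1 i; rewrite /= in_itv /= -ler_norml -(@expr_le1 _ 2) // -v1.
rewrite (bigD1 i) //= real_normK ?num_real // lerDl.
by apply: sumr_ge0 => j _; rewrite sqr_ge0.
Qed.

Lemma exists_max_on_sphere d n (u : 'I_n -> 'rV[R[i]]_d) : (0 < d)%N ->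
  exists2 x, unit_vector x &
    forall v, unit_vector v ->
      `|\prod_k dotmx v (u k)| <= `|\prod_k dotmx x (u k)|.
Proof.
move=> d0; pose f v : R[i] := \prod_k dotmx (complex_row v) (u k).
have [fr fi] : complex_continuous f.
  by apply: complex_continuous_prod => k; exact: complex_continuous_dotmx.
(* The squared modulus of [f]: a real-valued function with the same maximizers as the modulus. *)
pose F v : R := Re (f v) ^+ 2 + Im (f v) ^+ 2.
have Fc : continuous F.
  move=> v; rewrite /F; under eq_fun do rewrite !expr2.
  exact: (continuousD (continuousM (fr v) (fr v)) (continuousM (fi v) (fi v))).
pose S := [set v : 'rV[R]_(d + d) | \sum_i v 0 i ^+ 2 = 1].
have S0 : S !=set0.
  pose i : 'I_(d + d) := lshift d (Ordinal d0).
  exists (delta_mx 0 i); rewrite /S /= (bigD1 i) //= big1 => [|j ji].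
    by rewrite mxE !eqxx expr1n addr0.
  by rewrite mxE (negbTE ji) andbF expr0n.
have SE v : S v <-> unit_vector (complex_row v).
  rewrite unit_vectorE dnorm_complex_row /S /=.
  by split=> [->|v1]; [exact: rmorph1 | apply: complexI; rewrite v1 rmorph1].
have [c /set_mem cS cmax] := compact_EVT_max S0 (@compact_unit_sphere _)
  (continuous_subspaceT Fc).
have FE z : (F z)%:C = `|f z| ^+ 2 by exact: add_Re2_Im2.
exists (complex_row c); first exact/SE.
move=> x; have [v <-] := complex_row_surj x => /SE /mem_set /cmax Fv.
have fE z : \prod_k dotmx (complex_row z) (u k) = f z by [].
rewrite [X in `|X| <= _]fE [X in _ <= `|X|]fE.
clearbody f; move: Fv; rewrite -lecR [X in X <= _]FE [X in _ <= X]FE.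
by rewrite ler_pXn2r ?nnegrE.
Qed.
End Compactness.

(** * Extension to all vectors by homogeneity, and assembly *)

Lemma homogeneous_le_sphere (R : realType) d n (Q : 'rV[R[i]]_d -> R[i]) x :
    (0 < n)%N -> (forall c v, Q (c *: v) = `|c| ^+ n * Q v) -> 0 <= Q x ->
    (forall v, unit_vector v -> Q v <= Q x) ->
  forall v, Q v <= Q x * hermitian_norm v ^+ n.
Proof.
move=> n0 homog Qx0 x_max v.
have [v0|v0] := eqVneq (hermitian_norm v) 0.
  have /eqP -> : v == 0 by rewrite -(sqrt_dnorm_eq0 (@dotmx _ _)); apply/eqP.
  rewrite -(scale0r 0) homog normr0 expr0n gtn_eqF // mul0r.
  by rewrite mulr_ge0 ?exprn_ge0 ?hermitian_norm_ge0.
have nv := ger0_norm (hermitian_norm_ge0 v).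
rewrite -{1}(scale1r v) -(mulfV v0) -scalerA homog nv mulrC.
rewrite ler_wpM2r ?exprn_ge0 ?hermitian_norm_ge0 // x_max //.
by rewrite /unit_vector hermitian_normZ normfV nv mulVf.
Qed.

Theorem corollary1p7 (R : realType) (d : nat) (hd : (1 <= d)%N)
    (u y : 'I_d -> 'rV[R[i]]_d) (hu : forall j : 'I_d, unit_vector (u j)) :
  exists x : 'rV[R[i]]_d,
    unit_vector x /\
    (d%:R `^ (- (d%:R / 2)))%:C <=
      \prod_(j < d) `| dotmx (x - y j) (u j) | :> R[i].
Proof.
have [x x1 x_max] := exists_max_on_sphere u hd.
have Q_homog c v : `|\prod_k dotmx (c *: v) (u k)| =
    `|c| ^+ d * `|\prod_k dotmx v (u k)|.
  under eq_bigr => k _ do rewrite linearZl_LR /=.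
  by rewrite big_split /= prodr_const card_ord normrM normrX.
have {}x_max := homogeneous_le_sphere hd Q_homog (normr_ge0 _) x_max.
have u0 j : u j != 0.
  have /unit_vectorE := hu j; apply: contra_eq_neq => ->.
  by rewrite linear0l eq_sym oner_eq0.
have Qx0 : \prod_k dotmx x (u k) != 0.
  (* A zero maximum would force the product to vanish at every vector. *)
  have [v] := exists_nonvanishing u0; apply: contraNneq => Qx0.
  by have := x_max v; rewrite Qx0 normr0 mul0r normr_le0.
have factor_ge := maximizer_factor_ge hu x1 x_max Qx0.
have [s s1 le_s] := exists_dominating_phase
  (fun j => dotmx x (u j)) (fun j => dotmx (y j) (u j)).
exists (s *: x); split.
  by rewrite /unit_vector hermitian_normZ s1 mul1r.
under eq_bigr => j _ do rewrite linearBl linearZl_LR /=.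
(* [c] is [d^(-1/2)]: the bound splits into [d] equal factors, each compared after squaring with
   [factor_ge]. *)
apply: le_trans le_s; pose c : R := d%:R `^ (- 2^-1).
have -> : (d%:R `^ (- (d%:R / 2)))%:C = \prod_(j < d) c%:C.
  rewrite prodr_const card_ord -rmorphXn /= -powR_mulrn ?powR_ge0 // -powRrM.
  by congr (_ `^ _)%:C; rewrite mulNr mulrC.
apply: ler_prod => j _; rewrite ler0c powR_ge0 /=.
rewrite -(@ler_pXn2r _ 2) ?nnegrE ?normr_ge0 ?ler0c ?powR_ge0 //.
apply: le_trans (factor_ge j).
rewrite -rmorphXn /= -powR_mulrn ?powR_ge0 // -powRrM mulNr mulVf ?pnatr_eq0 //.
by rewrite powR_inv1 ?ler0n // fmorphV rmorph_nat.
Qed.
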